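(* Let $d\ge 1$ and let $\mathbf{M}=\{M_\alpha\}_{\alpha\in\mathbb{N}_0^d}$ be a normalized sequence of positive real numbers (that is, $M_0=1$) satisfying $$\lim_{|\alpha|\to+\infty}M_\alpha^{1/|\alpha|}=+\infty .$$ Then the sequence $\{M_\alpha\}_{\alpha\in\mathbb{N}_0^d}$ is log-convex if and only if $$M_\alpha=\sup_{s\in(0,+\infty)^d}\frac{s^\alpha}{\exp\omega_{\mathbf{M}}(s)},\qquad\forall\alpha\in\mathbb{N}_0^d .$$
   Context: $\mathbb{N}_0=\mathbb{N}\cup\{0\}$. For $\alpha\in\mathbb{N}_0^d$, $|\alpha|=\alpha_1+\cdots+\alpha_d$ and $s^\alpha=s_1^{\alpha_1}\cdots s_d^{\alpha_d}$ (with $0^0=1$). The associated function of a normalized sequence $\mathbf{M}$ is $\omega_{\mathbf{M}}(t):=\sup_{\alpha\in\mathbb{N}_0^d}\log\frac{|t^\alpha|}{M_\alpha}$ for $t\in\mathbb{R}^d$, with the convention $\log 0=-\infty$. The limit condition on $\mathbf{M}$ ensures $\omega_{\mathbf{M}}(t)<+\infty$ for all $t\in\mathbb{R}^d$. A sequence $\{M_\alpha\}_{\alpha\in\mathbb{N}_0^d}$ of positive real numbers is log-convex if there exists a convex function $F:[0,+\infty)^d\to\mathbb{R}$ with $F(\alpha)=\log M_\alpha$ for all $\alpha\in\mathbb{N}_0^d$. (Convexity is joint in all variables, not only coordinate-wise.) *)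

(* Defs.v *)
From HB Require Import structures.
From mathcomp Require Import all_boot all_order all_algebra.
From mathcomp Require Import all_classical all_reals all_analysis.

Set Implicit Arguments.
Unset Strict Implicit.
Unset Printing Implicit Defensive.

Import Order.TTheory GRing.Theory Num.Theory.
Import numFieldNormedType.Exports.

Local Open Scope classical_set_scope.
Local Open Scope ring_scope.

(* A multi-index is a row vector of naturals; points of R^d are row vectors. *)
Definition mabs (d : nat) (alpha : 'rV[nat]_d) : nat :=
  (\sum_(i < d) alpha 0%R i)%N.

Definition mpow (R : realType) (d : nat) (s : 'rV[R]_d) (alpha : 'rV[nat]_d) : R :=
  \prod_(i < d) s 0 i ^+ alpha 0 i.

Definition mreal (R : realType) (d : nat) (alpha : 'rV[nat]_d) : 'rV[R]_d :=
  \row_(i < d) (alpha 0 i)%:R.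

Definition nonneg_orthant (R : realType) (d : nat) : set 'rV[R]_d :=
  [set x | forall i, 0 <= x 0 i].

Definition pos_orthant (R : realType) (d : nat) : set 'rV[R]_d :=
  [set x | forall i, 0 < x 0 i].

(* The filter |alpha| -> +oo on multi-indices. *)
Definition mabs_infty (d : nat) : set_system 'rV[nat]_d :=
  filter_from setT (fun N : nat => [set alpha | (N <= mabs alpha)%N]).

#[global] Instance mabs_infty_filter (d : nat) : Filter (@mabs_infty d).
Proof.
apply: filter_from_filter; first by exists 0%N.
move=> m n _ _; exists (maxn m n) => // alpha /=.
by rewrite geq_max => /andP[].
Qed.

(* lne is the logarithm with values in \bar R, with lne 0 = -oo. *)
Definition assoc_fun (R : realType) (d : nat) (M : 'rV[nat]_d -> R)
    (t : 'rV[R]_d) : \bar R :=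
  ereal_sup [set lne (`|mpow t alpha| / M alpha)%:E | alpha in [set: 'rV[nat]_d]].

(* A function on [0, +oo)^d is represented by a total F : 'rV_d -> R of which
   only the restriction to the orthant is constrained. *)
Definition log_convex (R : realType) (d : nat) (M : 'rV[nat]_d -> R) : Prop :=
  exists F : 'rV[R]_d -> R,
    convex_function (@nonneg_orthant R d) F /\
    forall alpha : 'rV[nat]_d, F (mreal R alpha) = ln (M alpha).

(* Main.v *)
Require Import Defs.
From HB Require Import structures.
From mathcomp Require Import all_boot all_order all_algebra.
From mathcomp Require Import all_classical all_reals all_analysis.
From mathcomp Require Import ring lra.

Import Order.TTheory GRing.Theory Num.Theory.
Import numFieldNormedType.Exports.

Local Open Scope classical_set_scope.
Local Open Scope ring_scope.

(** Substituting s = exp sigma turns s^alpha into exp <alpha, sigma>, and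
    omega_M (exp sigma) <= c says exactly that the affine function
    beta |-> <beta, sigma> - c lies below log M on the lattice
    ([assoc_fun_le]).  Hence the supremum in the theorem is the exponential of
    the supremum at alpha of the affine minorants of log M, and the theorem
    says that log M has a convex extension to the closed orthant iff it is the
    upper envelope of its affine minorants.

    If log M is that envelope, then the same envelope evaluated at every point
    of the orthant is a convex extension.  It is finite because a point of the
    orthant lies below some lattice point in each coordinate where sigma is
    nonnegative, and above 0 in the others: comparing with the vertices of a
    box {0, n}^d bounds all affine minorants at once
    ([affine_minorant_ubound]).

    Conversely, let F be a convex extension.  A minorant touching log M at
    alpha is a subgradient of F restricted to the lattice.  The difficulty is
    that alpha may lie on the boundary of the orthant, where F itself may be
    discontinuous and have no subgradient.  For finitely many lattice points a
    subgradient exists by a theorem of the alternative ([finite_subgradient],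
    from [finite_cone_separation]).  Testing such a sigma on the neighbours
    alpha + e_i and alpha - e_i bounds every sigma_i from above, and from below
    when alpha_i > 0, by a constant that does not depend on the finite set.
    These bounds control <beta - alpha, sigma> linearly in |beta|, whereas the
    limit condition makes log M_beta superlinear, so the inequality
    is automatic outside a box that can be fixed beforehand: the subgradient
    for that box is a global one ([subgradient_superlinear]). *)

(** * Separating finite cones *)

Definition dot {R : pzRingType} {d : nat} (u v : 'rV[R]_d) : R :=
  \sum_(i < d) u 0 i * v 0 i.

Lemma dotDl {R : pzRingType} {d} (u v w : 'rV[R]_d) :
  dot (u + v) w = dot u w + dot v w.
Proof. by rewrite -big_split; apply: eq_bigr => i _; rewrite mxE mulrDl. Qed.

Lemma dotZl {R : pzRingType} {d} a (u w : 'rV[R]_d) :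
  dot (a *: u) w = a * dot u w.
Proof. by rewrite /dot mulr_sumr; apply: eq_bigr => i _; rewrite mxE mulrA. Qed.

Lemma dotBl {R : pzRingType} {d} (u v w : 'rV[R]_d) :
  dot (u - v) w = dot u w - dot v w.
Proof. by rewrite -scaleN1r dotDl dotZl mulN1r. Qed.

Lemma dot_deltal {R : pzRingType} {d} i (w : 'rV[R]_d) :
  dot (delta_mx 0 i) w = w 0 i.
Proof.
rewrite /dot (bigD1 i) //= mxE !eqxx mul1r big1 ?addr0 // => j /negbTE ji.
by rewrite mxE ji andbF mul0r.
Qed.

Lemma dot_addZdelta {R : comPzRingType} {d} i a (u w : 'rV[R]_d) :
  dot u (w + a *: delta_mx 0 i) = dot u w + a * u 0 i.
Proof.
rewrite -(dot_deltal i u) /dot mulr_sumr -big_split; apply: eq_bigr => j _ /=.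
by rewrite !mxE mulrDr !eqxx /=; congr (_ + _); ring.
Qed.

Lemma exists_between {R : realDomainType} (L U : seq R) :
  (forall l u, l \in L -> u \in U -> l <= u) ->
  exists x, (forall l, l \in L -> l <= x) /\ (forall u, u \in U -> x <= u).
Proof.
elim: L => [|a L IH] LU.
  elim: U {LU} => [|b U [x [_ xU]]]; first by exists 0.
  exists (Num.min x b); split=> // u; rewrite inE => /orP[/eqP->|/xU xu].
    by rewrite ge_min lexx orbT.
  by rewrite ge_min xu.
have [l u lL|x [Lx xU]] := IH; first by apply: LU; rewrite inE lL orbT.
exists (Num.max x a); split=> [l|u uU].
  by rewrite inE => /orP[/eqP->|/Lx lx]; rewrite le_max ?lexx ?orbT// lx.
by rewrite ge_max xU // LU // inE eqxx.
Qed.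

(** Farkas' lemma by Fourier-Motzkin elimination.  The convex cone [Q]
    contains the inequalities <u, sigma> <= a of the finite system, hence all
    their nonnegative combinations, and [Q 0 a -> 0 <= a] says that none of
    these is contradictory.  Since [Q] is
    kept abstract, no coefficients of combinations need to be recorded, and
    the convexity of a function can later be used directly as the closure of
    [Q] under addition. *)
Lemma finite_cone_separation {R : realFieldType} {d : nat}
    (Q : 'rV[R]_d -> R -> Prop) :
  (forall u v a b, Q u a -> Q v b -> Q (u + v) (a + b)) ->
  (forall t u a, 0 < t -> Q u a -> Q (t *: u) (t * a)) ->
  (forall a, Q 0 a -> 0 <= a) ->
  forall s : seq ('rV[R]_d * R), (forall p, p \in s -> Q p.1 p.2) ->
  exists sigma, forall p, p \in s -> dot p.1 sigma <= p.2.
Proof.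
move=> QD QZ Q0.
(* Induction on the number k of coordinates that the system still involves. *)
suff elim_coord k : (k <= d)%N -> forall s : seq ('rV[R]_d * R),
    (forall p, p \in s -> Q p.1 p.2) ->
    (forall p, p \in s -> forall i : 'I_d, (k <= i)%N -> p.1 0 i = 0) ->
    exists sigma, forall p, p \in s -> dot p.1 sigma <= p.2.
  move=> s sQ; apply: (elim_coord d (leqnn d) s sQ) => p _ i.
  by rewrite leqNgt ltn_ord.
elim: k => [_|k IH kd] s sQ s0.
  exists 0 => p ps; have p0 : p.1 = 0.
    by apply/rowP => i; rewrite s0 // mxE.
  have := sQ p ps; rewrite p0 => /Q0.
  by rewrite /dot big1 // => i _; rewrite mxE mul0r.
pose i0 := Ordinal kd; pose co (p : 'rV[R]_d * R) := p.1 0 i0.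
pose P := [seq p <- s | 0 < co p]; pose N := [seq p <- s | co p < 0].
(* Adding n scaled by co p > 0 to p scaled by - co n > 0 cancels the
   coordinate k. *)
pose cb (p n : 'rV[R]_d * R) :=
  (- co n *: p.1 + co p *: n.1, - co n * p.2 + co p * n.2).
pose s' := [seq p <- s | co p == 0] ++ [seq cb p n | p <- P, n <- N].
have [||sigma sigmaP] := IH (ltnW kd) s'.
- move=> p; rewrite mem_cat => /orP[|/allpairsP[[p1 n] [/=]]].
    by rewrite mem_filter => /andP[_ /sQ].
  rewrite !mem_filter => /andP[p0 ps] /andP[n0 ns] ->.
  by apply: QD; apply: QZ; rewrite ?oppr_gt0 //; exact: sQ.
- move=> p + i; rewrite mem_cat leq_eqVlt => ps /orP[/eqP ki|ki].
    have -> : i = i0 by exact: val_inj.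
    case/orP: ps => [|/allpairsP[[p1 n] [/= _ _ ->]]].
      by rewrite mem_filter => /andP[/eqP].
    by rewrite !mxE -/(co p1) -/(co n) mulNr mulrC addNr.
  case/orP: ps => [|/allpairsP[[p1 n] [/=]]].
    by rewrite mem_filter => /andP[_ ps]; exact: s0.
  rewrite !mem_filter => /andP[p0 ps] /andP[n0 ns] ->.
  by rewrite !mxE !s0 // !mulr0 addr0.
(* Each inequality with a nonzero coordinate k bounds the amount by which
   sigma may be moved in the direction k, from below if the coordinate is
   negative and from above if it is positive; the combined inequalities say
   that these bounds are compatible. *)
pose bd (p : 'rV[R]_d * R) := (p.2 - dot p.1 sigma) / co p.
have [|x [Nx xP]] := exists_between (map bd N) (map bd P).
  move=> _ _ /mapP[n nN ->] /mapP[p pP ->].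
  have : cb p n \in s' by rewrite mem_cat allpairs_f ?orbT.
  move=> /sigmaP /=; rewrite dotDl !dotZl => le.
  move: nN pP; rewrite !mem_filter => /andP[n0 _] /andP[p0 _].
  rewrite ler_ndivrMr // /bd mulrAC ler_pdivrMr //.
  by rewrite -subr_ge0; nra.
exists (sigma + x *: delta_mx 0 i0) => p ps.
rewrite dot_addZdelta -/(co p) addrC -lerBrDr.
have [p0|p0|p0] := ltgtP (co p) 0.
- rewrite -ler_ndivrMr //; apply: Nx.
  by apply: (map_f bd); rewrite mem_filter p0.
- rewrite -ler_pdivlMr //; apply: xP.
  by apply: (map_f bd); rewrite mem_filter p0.
- rewrite p0 mulr0 subr_ge0; apply: sigmaP.
  by rewrite mem_cat mem_filter p0 eqxx ps.
Qed.

(** * Subgradients of convex functions *)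

Lemma convex_functionP {R : numFieldType} {E : lmodType R} (D : set E)
    (F : E -> R) x y t u :
  convex_function D F -> D x -> D y -> 0 <= t -> 0 <= u -> t + u = 1 ->
  F (t *: x + u *: y) <= t * F x + u * F y.
Proof.
move=> cF Dx Dy t0 u0 tu.
have t1 : t <= 1 by rewrite -tu lerDl.
have -> : u = 1 - t by rewrite -tu addrAC subrr add0r.
have := cF (Itv01 t0 t1) x y; rewrite !inE => /(_ Dx Dy).
by [].
Qed.

Lemma convex_setP {R : numFieldType} {E : lmodType R} (D : set E) x y t u :
  convex_set D -> D x -> D y -> 0 <= t -> 0 <= u -> t + u = 1 ->
  D (t *: x + u *: y).
Proof.
move=> cD Dx Dy t0 u0 tu.
have t1 : t <= 1 by rewrite -tu lerDl.
have -> : u = 1 - t by rewrite -tu addrAC subrr add0r.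
by have := cD x y (Itv01 t0 t1); rewrite !inE => /(_ Dx Dy).
Qed.

(** The inequalities on sigma are implied by those of the cone
    [Q v c], generated by the pairs (y - a, F y - F a) with y in the domain.
    Convexity of [F] makes it stable under addition, and over v = 0 it only
    contains nonnegative c because y = a there, so the system is consistent.
    Finiteness of [s] matters: at a boundary point of [D] a subgradient for
    all of [D] need not exist. *)
Lemma finite_subgradient {R : realFieldType} {d : nat} (D : set 'rV[R]_d)
    (F : 'rV[R]_d -> R) (a : 'rV[R]_d) (s : seq 'rV[R]_d) :
  convex_set D -> convex_function D F -> D a -> (forall b, b \in s -> D b) ->
  exists sigma, forall b, b \in s -> F a + dot (b - a) sigma <= F b.
Proof.
move=> cD cF Da Ds.
pose Q v c := exists t y, [/\ 0 < t, D y, v = t *: (y - a) &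
  t * (F y - F a) <= c].
have [| | | |sigma sigmaP] :=
    @finite_cone_separation R d Q _ _ _ [seq (b - a, F b - F a) | b <- s].
- move=> v w b c [t [y [t0 Dy -> tb]]] [u [z [u0 Dz -> uc]]].
  have tu0 : 0 < t + u by rewrite addr_gt0.
  have tun0 : t + u != 0 by rewrite gt_eqF.
  have tu1 : t / (t + u) + u / (t + u) = 1 by rewrite -mulrDl divff.
  have t'0 : 0 <= t / (t + u) by rewrite divr_ge0 // ltW.
  have u'0 : 0 <= u / (t + u) by rewrite divr_ge0 // ltW.
  exists (t + u), ((t / (t + u)) *: y + (u / (t + u)) *: z); split=> //.
  + exact: convex_setP.
  + rewrite [RHS]scalerBr [in RHS]scalerDr !scalerA ![(t + u) * (_ / _)]mulrC.
    by rewrite !divfK // !scalerBr scalerDl opprD addrACA.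
  + apply: le_trans (lerD tb uc).
    have := convex_functionP _ _ _ _ _ _ cF Dy Dz t'0 u'0 tu1.
    rewrite -(ler_pM2l tu0) mulrDr !mulrA ![(t + u) * _ / _]mulrAC divff //.
    by rewrite !mul1r; nra.
- move=> t v c t0 [u [y [u0 Dy -> uc]]].
  exists (t * u), y; split=> //; first by rewrite mulr_gt0.
    by rewrite scalerA.
  by rewrite -mulrA ler_pM2l.
- move=> c [t [y [t0 _ /esym/eqP + tc]]].
  rewrite scaler_eq0 gt_eqF //= subr_eq0 => /eqP ya.
  by rewrite ya subrr mulr0 in tc.
- move=> _ /mapP[b bs ->] /=; exists 1, b.
  by split=> //; rewrite ?scale1r ?mul1r //; exact: Ds.
exists sigma => b bs.
by rewrite addrC -lerBrDr; apply: (sigmaP _ (map_f _ bs)).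
Qed.

(** * Affine minorants of functions of multi-indices *)

Section MultiIndex.
Context {R : realType} {d : nat}.
Implicit Types (alpha beta : 'rV[nat]_d) (sigma : 'rV[R]_d).

Lemma mreal_orthant alpha : nonneg_orthant (mreal R alpha).
Proof. by move=> i; rewrite mxE. Qed.

Lemma mrealD alpha beta : mreal R (alpha + beta) = mreal R alpha + mreal R beta.
Proof. by apply/rowP => i; rewrite !mxE natrD. Qed.

Lemma mreal_delta i : mreal R (delta_mx 0 i : 'rV[nat]_d) = delta_mx 0 i.
Proof. by apply/rowP => j; rewrite !mxE; case: (_ && _). Qed.

Lemma leq_mabs alpha i : (alpha 0%R i <= mabs alpha)%N.
Proof. by rewrite /mabs (bigD1 i) //= leq_addr. Qed.

Lemma mabsE alpha : (mabs alpha)%:R = \sum_(i < d) mreal R alpha 0 i :> R.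
Proof. by rewrite natr_sum; apply: eq_bigr => i _; rewrite mxE. Qed.

Lemma multi_index_box n : exists s : seq 'rV[nat]_d,
  forall alpha, (forall i, alpha 0%R i <= n)%N -> alpha \in s.
Proof.
exists [seq map_mx val b | b <- enum 'rV['I_n.+1]_d] => alpha le_n.
apply/mapP; exists (map_mx inord alpha); first by rewrite mem_enum.
by apply/rowP => i; rewrite !mxE /= inordK // ltnS le_n.
Qed.

Lemma bounded_on_box (f : 'rV[nat]_d -> R) n : exists B,
  forall alpha, (forall i, alpha 0%R i <= n)%N -> `|f alpha| <= B.
Proof.
have [s sP] := multi_index_box n.
exists (\sum_(b <- s) `|f b|) => alpha /sP; elim: s {sP} => // b s IH.
rewrite inE big_cons => /orP[/eqP->|/IH le]; first by rewrite lerDl sumr_ge0.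
by rewrite (le_trans le) // lerDr.
Qed.

Lemma dot_le_mabs alpha sigma K :
  (forall i, (0 < alpha 0%R i)%N -> sigma 0 i <= K) ->
  dot (mreal R alpha) sigma <= K * (mabs alpha)%:R.
Proof.
move=> le_K; rewrite mabsE mulr_sumr; apply: ler_sum => i _.
rewrite mxE mulrC; have [->|/le_K le] := posnP (alpha 0 i).
  by rewrite !mulr0.
by rewrite ler_wpM2r.
Qed.

Lemma root_growth (M : 'rV[nat]_d -> R) :
  (forall alpha, 0 < M alpha) ->
  M alpha `^ ((mabs alpha)%:R^-1) @[alpha --> @mabs_infty d] --> +oo ->
  forall C, exists N, forall alpha, (N <= mabs alpha)%N ->
    C * (mabs alpha)%:R <= ln (M alpha).
Proof.
move=> Mpos /cvgryPge/(_ (expR _)) Mlim C.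
have [N _ NP] := Mlim C; exists N.+1 => alpha N_lt.
have a0 : 0 < (mabs alpha)%:R :> R by rewrite ltr0n (leq_trans _ N_lt).
have /= := NP alpha (ltnW N_lt).
rewrite -ler_ln ?posrE ?expR_gt0 ?powR_gt0 // expRK ln_powR.
by rewrite mulrC ler_pdivlMr.
Qed.

Lemma nonneg_orthant_convex : convex_set (@nonneg_orthant R d).
Proof.
move=> x y t; rewrite !inE => x0 y0 i.
by rewrite !mxE addr_ge0 // mulr_ge0 // subr_ge0.
Qed.

Definition affine_minorant (f : 'rV[nat]_d -> R) sigma (c : R) : Prop :=
  forall beta, dot (mreal R beta) sigma - c <= f beta.

(** Superlinear growth turns the subgradients on finite sets into a global one,
    provided that the slopes of those subgradients are bounded independently of
    the finite set.  The neighbours of [alpha] give such bounds; when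
    alpha_i = 0 the slope in the direction i is not bounded from below, but
    it then does not enter <alpha, sigma>. *)
Lemma subgradient_superlinear (F : 'rV[R]_d -> R) :
  convex_function (@nonneg_orthant R d) F ->
  (forall C, exists N, forall beta, (N <= mabs beta)%N ->
    C * (mabs beta)%:R <= F (mreal R beta)) ->
  forall alpha, exists sigma, affine_minorant (F \o @mreal R d) sigma
    (dot (mreal R alpha) sigma - F (mreal R alpha)).
Proof.
move=> cF growth alpha; set m := mabs alpha.
have [B BP] := bounded_on_box (F \o @mreal R d) m.+1.
have Ba : `|F (mreal R alpha)| <= B.
  by apply: BP => i; rewrite leqW // leq_mabs.
have B0 : 0 <= B by exact: le_trans Ba.
(* For |beta| >= 1 this slope dominates F alpha + <beta - alpha, sigma>, which
   is at most B + 2 B |beta| + 2 B |alpha| by the bounds proved below. *)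
have [N NP] := growth (B + 2 * B + 2 * B * m%:R).
pose n := maxn m.+1 N.+1; have [s sP] := multi_index_box n.
have [|sigma sigmaP] := finite_subgradient _ F (mreal R alpha)
    [seq mreal R b | b <- s] nonneg_orthant_convex cF (mreal_orthant alpha).
  by move=> _ /mapP[b _ ->]; exact: mreal_orthant.
have {}sigmaP beta : (forall i, beta 0%R i <= n)%N ->
    F (mreal R alpha) + dot (mreal R beta - mreal R alpha) sigma
    <= F (mreal R beta).
  by move=> /sP bs; apply: sigmaP; exact: map_f.
have small beta : (forall i, beta 0%R i <= m.+1)%N ->
    dot (mreal R beta - mreal R alpha) sigma <= 2 * B.
  move=> le_m; have := BP beta le_m.
  have /sigmaP : forall i, (beta 0%R i <= n)%N.
    by move=> i; rewrite (leq_trans (le_m i)) // leq_maxl.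
  by move: Ba; rewrite !ler_norml /= => ? ? ?; lra.
have sigma_le i : sigma 0 i <= 2 * B.
  have := small (alpha + delta_mx 0 i).
  rewrite mrealD mreal_delta addrAC subrr add0r dot_deltal; apply=> j.
  rewrite !mxE eqxx /= -[m.+1]addn1; apply: leq_add; first exact: leq_mabs.
  by case: (j == i).
have sigma_ge i : (0 < alpha 0%R i)%N -> - sigma 0 i <= 2 * B.
  move=> ai; pose beta : 'rV[nat]_d := \row_j (alpha 0%R j - (j == i))%N.
  have ab : alpha = beta + delta_mx 0 i.
    apply/rowP => j; rewrite !mxE eqxx /=; case: eqP => [->|_] /=.
      by rewrite [RHS]subnK.
    by rewrite subn0 [RHS]addn0.
  have := small beta; rewrite ab mrealD mreal_delta opprD addNKr.
  rewrite -scaleN1r dotZl dot_deltal mulN1r; apply=> j.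
  by rewrite mxE leqW // (leq_trans (leq_subr _ _)) ?leq_mabs.
exists sigma => beta /=; rewrite opprB addrCA -dotBl.
have [le_n|lt_n] := leqP (mabs beta) n.
  by apply: sigmaP => i; exact: leq_trans (leq_mabs _ _) le_n.
have Nb : (N <= mabs beta)%N.
  by apply: leq_trans (ltnW lt_n); rewrite leq_max leqnSn orbT.
have b1 : 1 <= (mabs beta)%:R :> R.
  by rewrite ler1n (leq_trans _ (ltnW lt_n)) // leq_max.
apply: le_trans (NP beta Nb); rewrite dotBl.
have bK := dot_le_mabs beta sigma (2 * B) (fun i _ => sigma_le i).
have aK : - dot (mreal R alpha) sigma <= 2 * B * m%:R.
  have := dot_le_mabs alpha (- sigma) (2 * B).
  rewrite /dot -sumrN => H; apply: le_trans (H _) => [|i ai].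
    by apply: ler_sum => i _; rewrite !mxE mulrN.
  by rewrite mxE; exact: sigma_ge.
have m0 : 0 <= m%:R :> R by [].
have Bm0 : 0 <= B * m%:R by rewrite mulr_ge0.
move: Ba; rewrite ler_norml => /andP[_ Ba].
have : 0 <= (B + 2 * (B * m%:R)) * ((mabs beta)%:R - 1).
  by rewrite mulr_ge0 ?subr_ge0 // addr_ge0 // mulr_ge0.
by nra.
Qed.

(** This is a real supremum, hence it is meaningful only where the affine
    minorants are bounded and if there is at least one. *)
Definition convex_envelope (f : 'rV[nat]_d -> R) (x : 'rV[R]_d) : R :=
  sup [set y | exists sigma c,
        affine_minorant f sigma c /\ y = dot x sigma - c].

(** On the orthant, <x, sigma> only grows when x_i is replaced by n for
    sigma_i >= 0 and by 0 for sigma_i < 0, which leads to a vertex of the box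
    {0, n}^d, where a minorant is below [f].  Thus a bound of [f] on the box
    serves for all minorants. *)
Lemma affine_minorant_ubound f (x : 'rV[R]_d) : nonneg_orthant x ->
  exists B, forall sigma c, affine_minorant f sigma c -> dot x sigma - c <= B.
Proof.
move=> x0; have [n nP] : exists n, forall i, x 0 i <= n%:R.
  exists (Num.truncn (\sum_i x 0 i)).+1 => i.
  apply: le_trans (ltW (truncnS_gt _)).
  by rewrite (bigD1 i) //= lerDl sumr_ge0.
have [B BP] := bounded_on_box f n; exists B => sigma c minor.
pose beta : 'rV[nat]_d := \row_i (if 0 <= sigma 0 i then n else 0%N).
have /BP : forall i, (beta 0%R i <= n)%N by move=> i; rewrite mxE; case: ifP.
move=> /(le_trans (ler_norm _)); apply: le_trans.
apply: le_trans (minor beta); rewrite lerD2r; apply: ler_sum => i _.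
rewrite !mxE; case: (leP 0 (sigma 0 i)) => [s0|/ltW s0].
  by rewrite ler_wpM2r.
by rewrite mul0r mulr_ge0_le0.
Qed.

Lemma convex_envelope_ge f sigma c x : nonneg_orthant x ->
  affine_minorant f sigma c -> dot x sigma - c <= convex_envelope f x.
Proof.
move=> x0 minor; have [B BP] := affine_minorant_ubound f x x0.
apply: ub_le_sup; last by exists sigma, c.
by exists B => _ [tau [b [minor' ->]]]; exact: BP.
Qed.

Lemma convex_envelope_le f x b : (exists sigma c, affine_minorant f sigma c) ->
  (forall sigma c, affine_minorant f sigma c -> dot x sigma - c <= b) ->
  convex_envelope f x <= b.
Proof.
move=> [sigma [c minor]] bP; apply: ge_sup.
  by exists (dot x sigma - c), sigma, c.
by move=> _ [tau [e [minor' ->]]]; exact: bP.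
Qed.

Lemma convex_envelope_convex f : (exists sigma c, affine_minorant f sigma c) ->
  convex_function (@nonneg_orthant R d) (convex_envelope f).
Proof.
move=> exf t x y; rewrite !inE => x0 y0; apply: convex_envelope_le => //.
move=> sigma c minor; rewrite convRE dotDl !dotZl.
have := convex_envelope_ge _ _ _ _ x0 minor.
have := convex_envelope_ge _ _ _ _ y0 minor.
have t0 : 0 <= t%:num by [].
have t1 : 0 <= 1 - t%:num by rewrite subr_ge0.
move=> /(ler_wpM2l t1) + /(ler_wpM2l t0); rewrite /unstable.onem => ? ?; lra.
Qed.

End MultiIndex.

(** * The associated function in logarithmic coordinates *)

Section AssociatedFunction.
Context {R : realType} {d : nat} (M : 'rV[nat]_d -> R)
  (Mpos : forall alpha, 0 < M alpha).
Implicit Types (alpha : 'rV[nat]_d) (sigma : 'rV[R]_d).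

Let logM alpha := ln (M alpha).

Lemma mpow_expR sigma alpha :
  mpow (map_mx expR sigma) alpha = expR (dot (mreal R alpha) sigma).
Proof.
rewrite expR_sum; apply: eq_bigr => i _.
by rewrite !mxE expRM_natl.
Qed.

Lemma pos_orthant_expR (s : 'rV[R]_d) :
  pos_orthant s <-> exists sigma, s = map_mx expR sigma.
Proof.
split=> [s0|[sigma ->] i]; last by rewrite mxE expR_gt0.
by exists (map_mx (@ln R) s); apply/rowP => i; rewrite !mxE lnK // posrE s0.
Qed.

(** The associated function at exp sigma is the least constant [c] for which
    the affine function of slope [sigma] is a minorant of log M: it is the
    Legendre conjugate of log M. *)
Lemma assoc_fun_le sigma c :
  (assoc_fun M (map_mx expR sigma) <= c%:E)%E <-> affine_minorant logM sigma c.
Proof.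
have termE beta :
    lne (`|mpow (map_mx expR sigma) beta| / M beta)%:E =
    (dot (mreal R beta) sigma - logM beta)%:E.
  rewrite mpow_expR gtr0_norm ?expR_gt0 // lne_EFin ?divr_gt0 ?expR_gt0 //.
  by rewrite ln_div ?posrE ?expR_gt0 // expRK.
split=> [/ereal_supP le beta|minor].
  have := le _ (ex_intro2 _ _ beta I erefl).
  by rewrite termE lee_fin lerBlDr addrC -lerBlDr.
apply/ereal_supP => _ [beta _ <-].
by rewrite termE lee_fin lerBlDr addrC -lerBlDr.
Qed.

Lemma assoc_fun_gtNy sigma : (-oo < assoc_fun M (map_mx expR sigma))%E.
Proof.
rewrite ltNge leeNy_eq; apply/eqP => wNy.
have /assoc_fun_le/(_ 0) : (assoc_fun M (map_mx expR sigma) <=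
    (dot (mreal R 0) sigma - logM 0 - 1)%:E)%E by rewrite wNy leNye.
by move: wNy => _; lra.
Qed.

(** When the associated function is infinite at exp sigma, no minorant has
    slope [sigma] and the quotient is 0, so the bound holds with a vacuous
    hypothesis. *)
Lemma mpow_div_assoc_le sigma alpha (b : R) :
  (forall c, affine_minorant logM sigma c ->
    dot (mreal R alpha) sigma - c <= b) ->
  ((mpow (map_mx expR sigma) alpha)%:E /
    expeR (assoc_fun M (map_mx expR sigma)) <= (expR b)%:E)%E.
Proof.
have := assoc_fun_le sigma; have := assoc_fun_gtNy sigma; case: (assoc_fun _ _) => [w||] // _ minorP le_b /=.
- rewrite inver gt_eqF ?expR_gt0 // mpow_expR -EFinM -expRN -expRD.
  by rewrite lee_fin ler_expR; apply: le_b; apply/minorP.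
- by rewrite invey mule0 lee_fin expR_ge0.
Qed.

Lemma mpow_div_assoc_ge sigma alpha c : affine_minorant logM sigma c ->
  ((expR (dot (mreal R alpha) sigma - c))%:E <=
   (mpow (map_mx expR sigma) alpha)%:E /
    expeR (assoc_fun M (map_mx expR sigma)))%E.
Proof.
have := assoc_fun_le sigma; have := assoc_fun_gtNy sigma; case: (assoc_fun _ _) => [w||] // _ minorP minor /=.
- rewrite inver gt_eqF ?expR_gt0 // mpow_expR -EFinM -expRN -expRD.
  by rewrite lee_fin ler_expR lerD2l lerN2 -lee_fin; apply/minorP.
- by move/minorP: minor; rewrite leye_eq.
Qed.

Lemma mpow_div_assoc_sup_le alpha :
  (ereal_sup [set ((mpow s alpha)%:E / expeR (assoc_fun M s))%E
     | s in @pos_orthant R d] <= (M alpha)%:E)%E.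
Proof.
apply/ereal_supP => _ [s /pos_orthant_expR[sigma ->] <-].
rewrite -[M alpha]lnK ?posrE //; apply: mpow_div_assoc_le => c minor.
exact: minor.
Qed.

End AssociatedFunction.

(** * Log-convexity as biduality *)

Theorem theorem5p2 (R : realType) (d : nat) (hd : (1 <= d)%N)
    (M : 'rV[nat]_d -> R)
    (Mpos : forall alpha, 0 < M alpha)
    (M0 : M 0 = 1)
    (Mlim : (M alpha `^ ((mabs alpha)%:R^-1)) @[alpha --> @mabs_infty d] --> +oo) :
  log_convex M <->
  forall alpha : 'rV[nat]_d,
    (M alpha)%:E =
    ereal_sup [set ((mpow s alpha)%:E / expeR (assoc_fun M s))%E
              | s in @pos_orthant R d].
Proof.
split=> [[F [cF FM]] alpha|MsupE].
- apply/eqP; rewrite eq_le mpow_div_assoc_sup_le // andbT.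
  have [C|sigma minor] := subgradient_superlinear F cF _ alpha.
    have [N NP] := root_growth M Mpos Mlim C.
    by exists N => beta; rewrite FM; exact: NP.
  apply: le_ereal_sup_tmp; eexists.
    by exists (map_mx expR sigma) => //; apply/pos_orthant_expR; exists sigma.
  rewrite FM in minor.
  have {}minor : affine_minorant (fun beta => ln (M beta)) sigma
      (dot (mreal R alpha) sigma - ln (M alpha)).
    by move=> beta; rewrite -(FM beta); exact: minor.
  apply: le_trans (mpow_div_assoc_ge M Mpos sigma alpha _ minor).
  by rewrite subKr lnK ?posrE.
- pose logM beta := ln (M beta).
  (* A positive supremum has a positive term, and then the associated function
     is finite there. *)
  have exf : exists sigma c, affine_minorant logM sigma c.
    have : (0 < ereal_sup [set ((mpow s 0)%:E / expeR (assoc_fun M s))%E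
              | s in @pos_orthant R d])%E by rewrite -MsupE lte_fin.
    move=> /ereal_sup_gt[_ [s /pos_orthant_expR[sigma ->] <-]].
    have := assoc_fun_le M Mpos sigma.
    case: (assoc_fun _ _) => [w||] minorP.
    + by exists sigma, w; apply/minorP.
    + by rewrite invey mule0 ltxx.
    + by exists sigma, 0; apply/minorP; rewrite leNye.
  exists (convex_envelope logM); split; first exact: convex_envelope_convex.
  move=> alpha; apply/eqP; rewrite eq_le; apply/andP; split.
    by apply: convex_envelope_le => // sigma c minor; exact: minor.
  rewrite -ler_expR lnK ?posrE // -lee_fin MsupE.
  apply/ereal_supP => _ [s /pos_orthant_expR[sigma ->] <-].
  apply: mpow_div_assoc_le => // c minor.
  by apply: convex_envelope_ge => //; exact: mreal_orthant.
Qed.
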